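(* Let $\hat h$ be the Hamiltonian of a $d$-dimensional quantum system ($d<\infty$) with ground-state energy $0$, and let $\Lambda$ be any linear, completely positive, trace preserving (LCPT) map on that system. For any $\mathfrak{e}\in[0,\|\hat h\|_\infty]$, $$C_{\rm sep}(\Lambda;\mathfrak{e})\ \geq\ C_{\rm loc}(\Lambda;\mathfrak{e}).$$
   Context: A quantum cell (q-cell) is a system with Hilbert space $\mathbb{C}^d$ and self-adjoint Hamiltonian $\hat h$ whose smallest eigenvalue is $0$; $\|\hat h\|_\infty$ is its operator norm. For $n\ge1$, $n$ non-interacting q-cells have Hilbert space $(\mathbb{C}^d)^{\otimes n}$ and Hamiltonian $\hat H^{(n)}=\hat h_1+\dots+\hat h_n$, where $\hat h_i$ acts as $\hat h$ on the $i$-th factor and as the identity on the others. States are density matrices. The mean energy of a state $\hat\rho$ with respect to a Hamiltonian $\hat H$ is $\mathfrak{E}(\hat\rho;\hat H):=\mathrm{Tr}[\hat\rho\hat H]$. Noise acts on $n$ q-cells as $\Lambda^{\otimes n}$. Ergotropy of a state $\hat\rho$ of a $D$-dimensional system with Hamiltonian $\hat H$: $\mathcal{E}(\hat\rho;\hat H):=\max_{\hat U\in\mathbb{U}(D)}\{\mathfrak{E}(\hat\rho;\hat H)-\mathfrak{E}(\hat U\hat\rho\hat U^\dagger;\hat H)\}$, where $\mathbb{U}(D)$ is the group of $D\times D$ unitary matrices. Local ergotropy of a state $\hat\rho$ of $n$ q-cells: $\mathcal{E}_{\rm loc}(\hat\rho;\hat H^{(n)}):=\max_{\hat U_1,\dots,\hat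 U_n\in\mathbb{U}(d)}\{\mathfrak{E}(\hat\rho;\hat H^{(n)})-\mathfrak{E}((\hat U_1\otimes\cdots\otimes\hat U_n)\hat\rho(\hat U_1\otimes\cdots\otimes\hat U_n)^\dagger;\hat H^{(n)})\}$. Let $\mathfrak{S}^{(n)}_E$ be the set of states $\hat\rho^{(n)}$ of $n$ q-cells with $\mathfrak{E}(\hat\rho^{(n)};\hat H^{(n)})\le E$, and $\mathfrak{S}^{(n)}_{E,\rm sep}$ the subset of (fully) separable states, i.e. convex combinations of product states over the $n$ q-cells. Define $\mathcal{E}^{(n)}_{\rm sep}(\Lambda;E):=\max_{\hat\rho^{(n)}\in\mathfrak{S}^{(n)}_{E,\rm sep}}\mathcal{E}(\Lambda^{\otimes n}(\hat\rho^{(n)});\hat H^{(n)})$ and $\mathcal{E}^{(n)}_{\rm loc}(\Lambda;E):=\max_{\hat\rho^{(n)}\in\mathfrak{S}^{(n)}_E}\mathcal{E}_{\rm loc}(\Lambda^{\otimes n}(\hat\rho^{(n)});\hat H^{(n)})$. The capacitances are $C_{\rm sep}(\Lambda;\mathfrak{e}):=\lim_{n\to\infty}\mathcal{E}^{(n)}_{\rm sep}(\Lambda;n\mathfrak{e})/n$ (separable-input capacitance: arbitrary global unitaries, separable inputs) and $C_{\rm loc}(\Lambda;\mathfrak{e}):=\lim_{n\to\infty}\mathcal{E}^{(n)}_{\rm loc}(\Lambda;n\mathfrak{e})/n$ (local ergotropy capacitance: local unitaries, arbitrary inputs); these limits exist. *)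

(* Defs.v *)
From HB Require Import structures.
From mathcomp Require Import all_boot all_order all_algebra.
From mathcomp Require Import ring complex mxtens.
From mathcomp Require Import all_classical all_reals all_analysis.

Set Implicit Arguments.
Unset Strict Implicit.
Unset Printing Implicit Defensive.

Import Order.TTheory GRing.Theory Num.Theory.
Import numFieldNormedType.Exports.

Local Open Scope classical_set_scope.
Local Open Scope ring_scope.
Local Open Scope sesquilinear_scope.
Local Open Scope complex_scope.

Section FiniteDimensionalSystems.
Variables (R : realType) (D : nat).
Implicit Types (A H rho U : 'M[R[i]]_D) (v : 'cV[R[i]]_D).

(* On R[i], [0 <= z] means that z is real and nonnegative. *)
Definition psdmx A : Prop :=
  A \is hermsymmx /\ forall v, 0 <= (v^t* *m A *m v) 0 0.

Definition density rho : Prop := psdmx rho /\ \tr rho = 1.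

(* The trace is real whenever rho and H are Hermitian; Re only changes its
   type. *)
Definition energy rho H : R := complex.Re (\tr (rho *m H)).

(* All the maxima of this file are taken over nonempty bounded sets of reals
   and are attained, by compactness, so that they are given by sup (for the
   sets of states, when 0 <= E). *)
Definition ergotropy rho H : R :=
  sup [set energy rho H - energy (U *m rho *m U^t*) H
      | U in [set U : 'M[R[i]]_D | U \is unitarymx]].

Definition vnorm v : R := Num.sqrt (complex.Re ((v^t* *m v) 0 0)).

Definition opnorm A : R :=
  sup [set vnorm (A *m v) | v in [set v : 'cV[R[i]]_D | vnorm v = 1]].

(* Self-adjoint with smallest eigenvalue 0; this forces 0 < D. *)
Definition qcell_hamiltonian H : Prop :=
  [/\ H \is hermsymmx, eigenvalue H 0 & forall a, eigenvalue H a -> 0 <= a].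

End FiniteDimensionalSystems.

Section Channels.
Variables (R : realType) (d : nat).
Implicit Type L : {linear 'M[R[i]]_d -> 'M[R[i]]_d}.

Definition trace_preserving L : Prop := forall X, \tr (L X) = \tr X.

(* The map id_k (x) L, acting blockwise on C^k (x) C^d. *)
Definition ampliation k L (X : 'M[R[i]]_(k * d)) : 'M[R[i]]_(k * d) :=
  \sum_(i < k) \sum_(j < k)
    delta_mx i j *t
    L (\matrix_(a, b) X (mxtens_index (i, a)) (mxtens_index (j, b))).

Lemma ampliation_tens k L (A : 'M[R[i]]_k) (B : 'M[R[i]]_d) :
  ampliation L (A *t B) = A *t L B.
Proof.
rewrite /ampliation {2}[A]matrix_sum_delta; apply/matrixP => s t.
rewrite [RHS]mxE !summxE mulr_suml; apply: eq_bigr => i _.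
rewrite !summxE mulr_suml; apply: eq_bigr => j _.
rewrite (_ : \matrix_(a, b) _ = A i j *: B); last first.
  by apply/matrixP => a b; rewrite !mxE !mxtens_indexK.
by rewrite linearZ !mxE; ring.
Qed.

Definition completely_positive L : Prop :=
  forall (k : nat) (X : 'M[R[i]]_(k * d)), psdmx X -> psdmx (ampliation L X).

Definition lcpt L : Prop := completely_positive L /\ trace_preserving L.

End Channels.

(* The space (C^d)^{(x) n}: its canonical basis is indexed by the functions
   from 'I_n to 'I_d, numbered by enum_rank. *)
Definition ndim (n d : nat) : nat := #|{ffun 'I_n -> 'I_d}|.

Definition label n d (x : 'I_(ndim n d)) : {ffun 'I_n -> 'I_d} := enum_val x.

Section ManyCells.
Variables (R : realType) (d n : nat).
Local Notation nmx := 'M[R[i]]_(ndim n d).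

(* A 0 (x) ... (x) A n.-1 *)
Definition tens (A : 'I_n -> 'M[R[i]]_d) : nmx :=
  \matrix_(x, y) \prod_(i < n) A i (label x i) (label y i).

Definition nhamiltonian (h : 'M[R[i]]_d) : nmx :=
  \sum_(i < n) tens (fun k => if k == i then h else 1%:M).

(* The linear extension of tens A |-> tens (L \o A), defined on matrix units:
   the unit at (x, y) is the tensor product of the d x d matrix units at
   (x i, y i); see chan_pow_tens. *)
Definition chan_pow (L : {linear 'M[R[i]]_d -> 'M[R[i]]_d}) (X : nmx) : nmx :=
  \sum_x \sum_y
    X x y *: tens (fun i => L (delta_mx (label x i) (label y i))).

Lemma chan_pow_tens (L : {linear 'M[R[i]]_d -> 'M[R[i]]_d}) A :
  chan_pow L (tens A) = tens (fun i => L (A i)).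
Proof.
apply/matrixP => s t; rewrite /chan_pow summxE mxE.
under eq_bigr => x _ do rewrite summxE.
under eq_bigr => x _ do under eq_bigr => y _ do
  rewrite !mxE -big_split /=.
have Lij i : L (A i) (label s i) (label t i) =
    \sum_(a < d) \sum_(b < d)
      A i a b * L (delta_mx a b) (label s i) (label t i).
  rewrite {1}[A i]matrix_sum_delta linear_sum summxE; apply: eq_bigr => a _.
  rewrite linear_sum summxE; apply: eq_bigr => b _.
  by rewrite linearZ mxE.
under [RHS]eq_bigr => i _ do rewrite Lij.
rewrite bigA_distr_bigA /=.
rewrite (reindex_onto (fun f => enum_rank f) (fun x => enum_val x)) /=; last first.
  by move=> x _; rewrite enum_valK.
apply: eq_big => [f|f _]; first by rewrite /= enum_rankK eqxx.
rewrite bigA_distr_bigA /=.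
rewrite (reindex_onto (fun g => enum_rank g) (fun y => enum_val y)) /=; last first.
  by move=> y _; rewrite enum_valK.
apply: eq_big => [g|g _]; first by rewrite /= enum_rankK eqxx.
by apply: eq_bigr => i _; rewrite /label !enum_rankK.
Qed.

Definition local_ergotropy (rho H : nmx) : R :=
  sup [set energy rho H - energy (tens U *m rho *m (tens U)^t*) H
      | U in [set U : 'I_n -> 'M[R[i]]_d | forall i, U i \is unitarymx]].

Definition separable (rho : nmx) : Prop :=
  exists (m : nat) (p : 'I_m -> R) (sigma : 'I_m -> 'I_n -> 'M[R[i]]_d),
    [/\ forall j, 0 <= p j,
        \sum_j p j = 1,
        forall j i, density (sigma j i) &
        rho = \sum_j (p j)%:C *: tens (sigma j)].

Definition states (h : 'M[R[i]]_d) (E : R) : set nmx :=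
  [set rho | density rho /\ energy rho (nhamiltonian h) <= E].

Definition sep_states (h : 'M[R[i]]_d) (E : R) : set nmx :=
  [set rho | states h E rho /\ separable rho].

Definition max_ergotropy_sep (h : 'M[R[i]]_d)
    (L : {linear 'M[R[i]]_d -> 'M[R[i]]_d}) (E : R) : R :=
  sup [set ergotropy (chan_pow L rho) (nhamiltonian h)
      | rho in sep_states h E].

Definition max_ergotropy_loc (h : 'M[R[i]]_d)
    (L : {linear 'M[R[i]]_d -> 'M[R[i]]_d}) (E : R) : R :=
  sup [set local_ergotropy (chan_pow L rho) (nhamiltonian h)
      | rho in states h E].

End ManyCells.

Section Capacitances.
Variables (R : realType) (d : nat) (h : 'M[R[i]]_d).
Variable L : {linear 'M[R[i]]_d -> 'M[R[i]]_d}.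

(* limn is a total operator; for an LCPT map L and 0 <= e both sequences
   converge, so that it returns their limit. *)
Definition C_sep (e : R) : R :=
  limn (fun n => max_ergotropy_sep n h L (n%:R * e) / n%:R).

Definition C_loc (e : R) : R :=
  limn (fun n => max_ergotropy_loc n h L (n%:R * e) / n%:R).

End Capacitances.

(* Main.v *)
From HB Require Import structures.
Require Import Defs.
From mathcomp Require Import all_boot all_order all_algebra.
From mathcomp Require Import ring lra complex mxtens.
From mathcomp Require Import all_classical all_reals all_analysis.

(* The energies of n cells before and after local unitaries depend on a state
   only through its marginals. Replacing an input by the product of its
   marginals therefore changes neither its energy nor the gain, and the product
   is a separable input for which local unitaries are a special case of global
   ones: the bound holds for every n. To compare the limits one needs their
   existence: juxtaposing states and unitaries makes both sequences
   superadditive, they are nonnegative and at most linear in n, and Fekete's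
   lemma applies. *)

Import Order.TTheory GRing.Theory Num.Theory.
Local Open Scope ring_scope.
Local Open Scope complex_scope.

(** * Nested suprema and superadditive sequences of reals *)

Section RealSequences.
Set Implicit Arguments.
Unset Strict Implicit.
Unset Printing Implicit Defensive.
Import numFieldNormedType.Exports.
Local Open Scope classical_set_scope.

Section NestedSup.
Variables (R : realType) (T U : Type) (A : set T) (B : set U).
Variables (f : T -> U -> R) (M : R).
Hypotheses (A0 : A !=set0) (B0 : B !=set0).
Hypothesis fM : forall a b, A a -> B b -> f a b <= M.

Let inner a := sup [set f a b | b in B].

Let inner_le a z : (forall b, B b -> f a b <= z) -> inner a <= z.
Proof.
move=> fz; apply: ge_sup; first by case: B0 => b Bb; exists (f a b), b.
by move=> _ [b Bb <-]; exact: fz.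
Qed.

Let ub_inner a b : A a -> B b -> f a b <= inner a.
Proof.
move=> Aa Bb; apply: ub_le_sup; last by exists b.
by exists M => _ [c Bc <-]; exact: fM.
Qed.

(** Each of the two n-cell maxima is a supremum over states of a supremum over unitaries. This lemma
    and [le_nested_sup] let it be handled as a single supremum over pairs; the uniform bound [M]
    keeps the inner and outer sets bounded, so that [sup] is an upper bound. *)
Lemma nested_sup_le z : (forall a b, A a -> B b -> f a b <= z) ->
  sup [set sup [set f a b | b in B] | a in A] <= z.
Proof.
move=> fz; apply: ge_sup; first by case: A0 => a Aa; exists (inner a), a.
by move=> _ [a Aa <-]; apply: inner_le => b; exact: fz.
Qed.

Lemma le_nested_sup a b : A a -> B b ->
  f a b <= sup [set sup [set f a b | b in B] | a in A].
Proof.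
move=> Aa Bb; apply: (le_trans (ub_inner Aa Bb)); apply: ub_le_sup; last by exists a.
by exists M => _ [c Ac <-]; apply: inner_le => b' Bb'; exact: fM.
Qed.

End NestedSup.

(* Fekete's lemma, for a nonnegative sequence. *)
Lemma superadditive_is_cvg (R : realType) (u : nat -> R) (K : R) :
    (forall n, 0 <= u n) -> (forall n, u n <= n%:R * K) ->
    (forall m n, u m + u n <= u (m + n)%N) ->
  cvgn (fun n => u n / n%:R).
Proof.
move=> u0 uK uD.
have uMn q m : q%:R * u m <= u (q * m)%N.
  elim: q => [|q IH]; first by rewrite mul0r.
  by rewrite mulSn -natr1 mulrDl mul1r addrC (le_trans _ (uD _ _))// lerD2l.
have K0 : 0 <= K by rewrite -[K]mul1r (le_trans (u0 1%N))// (uK 1%N).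
pose v n := u n / n%:R.
have vK n : v n <= K.
  rewrite /v; case: n => [|n]; first by rewrite invr0 mulr0.
  by rewrite ler_pdivrMr ?ltr0n// mulrC uK.
have v0 n : 0 <= v n by rewrite divr_ge0.
have hsV : has_sup (range v).
  by split; [exists (v 0%N), 0%N | exists K => _ [n _ <-]].
apply/cvg_ex; exists (sup (range v)); apply/cvgrPdist_le => /= eps eps0.
have e20 : 0 < eps / 2 by rewrite divr_gt0.
(* The near-optimal index must be positive. If [sup_adherent] returns 0, then [v 0 = 0] because
   division by zero gives 0, and index 1 does at least as well since [v 1] is nonnegative. *)
have [m m0 hm] : exists2 m, (0 < m)%N & sup (range v) - eps / 2 < v m.
  have [_ [[|m] _ <-] hm] := sup_adherent e20 hsV; last by exists m.+1.
  by exists 1%N => //; rewrite (lt_le_trans hm)// {1}/v invr0 mulr0.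
have lev n : v n <= sup (range v) by apply: ub_le_sup; [exact: hsV.2|exists n].
near=> n.
rewrite -/(v n) ger0_norm ?subr_ge0 ?lev//.
have n0 : 0 < n%:R :> R by rewrite ltr0n; near: n; exists 1%N.
(* Euclidean division of [n] by [m]: superadditivity splits off the remainder, whose term is
   nonnegative. *)
have uqm : (n %/ m)%:R * u m <= u n.
  rewrite {2}(divn_eq n m) (le_trans (uMn _ _))// (le_trans _ (uD _ _))//.
  by rewrite lerDl.
have qm : n%:R - m%:R <= (n %/ m)%:R * m%:R :> R.
  rewrite lerBlDr -natrM -natrD ler_nat {1}(divn_eq n m) leq_add2l.
  by rewrite ltnW// ltn_pmod.
have um : u m = v m * m%:R by rewrite /v divfK// pnatr_eq0 -lt0n.
have key : v m * (n%:R - m%:R) <= u n.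
  by rewrite (le_trans _ uqm)// um mulrCA ler_wpM2l.
(* Dropping the remainder loses at most [v m * m], hence at most [K * m], which is below
   [eps / 2 * n] for large [n]. *)
have nb : K * m%:R <= eps / 2 * n%:R.
  suff: K * m%:R / (eps / 2) <= n%:R by rewrite ler_pdivrMr// [X in _ <= X]mulrC.
  by near: n; exact: nbhs_infty_ger.
have : v m - eps / 2 <= v n.
  rewrite {2}/v ler_pdivlMr// mulrBl (le_trans _ key)// mulrBr lerD2l lerN2.
  by rewrite (le_trans _ nb)// ler_wpM2r.
by move: hm; lra.
Unshelve. all: by end_near. Qed.

End RealSequences.

(** * Positive semidefinite matrices, density matrices and energy bounds *)

Section PositiveMatrices.
Set Implicit Arguments.
Unset Strict Implicit.
Unset Printing Implicit Defensive.
Local Open Scope sesquilinear_scope.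

Section Adjoint.
Variable C : numClosedFieldType.

Lemma adjmxE m n (A : 'M[C]_(m, n)) i j : (A^t*) i j = Num.conj (A j i).
Proof. by rewrite !mxE. Qed.

Lemma adjmxM m n p (A : 'M[C]_(m, n)) (B : 'M[C]_(n, p)) :
  (A *m B)^t* = B^t* *m A^t*.
Proof. by rewrite trmx_mul map_mxM. Qed.

Lemma adjmx1 n : (1%:M : 'M[C]_n)^t* = 1%:M.
Proof. by rewrite trmx1 map_mx1. Qed.

Lemma hermsymmxP n (A : 'M[C]_n) : reflect (A^t* = A) (A \is hermsymmx).
Proof.
apply: (iffP idP) => [/is_hermitianmxP|eqA].
  by rewrite expr0 scale1r => <-.
by apply/is_hermitianmxP; rewrite expr0 scale1r eqA.
Qed.

Lemma unitarymx_adjmxM n (U : 'M[C]_n) : U \is unitarymx -> U^t* *m U = 1%:M.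
Proof. by rewrite -trmxC_unitary => /unitarymxP; rewrite trmxCK. Qed.

Lemma mxtrace_adj n (A : 'M[C]_n) : \tr (A^t*) = Num.conj (\tr A).
Proof. by rewrite rmorph_sum; apply: eq_bigr => i _; rewrite adjmxE. Qed.

Lemma mxtrace_mul_delta n (A : 'M[C]_n) i j : \tr (A *m delta_mx i j) = A j i.
Proof.
rewrite /mxtrace (bigD1 j)//= big1 ?addr0 => [|k kj].
  rewrite mxE (bigD1 i)//= big1 ?addr0 => [|l li]; last first.
    by rewrite mxE (negbTE li) mulr0.
  by rewrite mxE !eqxx mulr1.
by rewrite mxE big1 // => l _; rewrite mxE (negbTE kj) andbF mulr0.
Qed.

End Adjoint.

Section Psd.
Variable R : realType.
Local Notation C := R[i].

Lemma gram_psdmx p D (B : 'M[C]_(p, D)) : psdmx (B^t* *m B).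
Proof.
split=> [|v]; first by apply/hermsymmxP; rewrite adjmxM trmxCK.
rewrite mulmxA -adjmxM -mulmxA mxE sumr_ge0 // => k _.
by rewrite adjmxE mulrC mul_conjC_ge0.
Qed.

(** The entry is the quadratic form of [A] at the adjoint of row [k] of [B]. *)
Lemma psdmx_conj_diag_ge0 p D (A : 'M[C]_D) (B : 'M[C]_(p, D)) k :
  psdmx A -> 0 <= (B *m A *m B^t*) k k.
Proof.
move=> [_ /(_ ((row k B)^t*))]; rewrite trmxCK -!row_mul.
congr (_ <= _).
by rewrite mxE [LHS]mxE [RHS]mxE; apply: eq_bigr => j _; rewrite !mxE.
Qed.

(** Diagonalise [A] by a unitary [P]; the eigenvalues are diagonal entries of [P *m A *m P^t*],
    hence nonnegative, and their square roots times [P] give [B]. Gram factors make stability under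
    conjugation and tensor products immediate. *)
Lemma psdmx_gram D (A : 'M[C]_D) :
  psdmx A -> exists B : 'M[C]_D, A = B^t* *m B.
Proof.
move=> psdA; have [hermA _] := psdA.
have /orthomx_spectralP := hermitian_normalmx hermA.
set P := spectralmx A; set s := spectral_diag A => eqA.
have uP : P \is unitarymx by exact: spectral_unitarymx.
have PP := unitarymxP uP.
have s0 k : 0 <= s 0 k.
  have := psdmx_conj_diag_ge0 P k psdA.
  rewrite eqA invmx_unitary// !mulmxA PP mul1mx -mulmxA PP mulmx1.
  by rewrite mxE eqxx mulr1n.
exists (diag_mx (map_mx sqrtC s) *m P).
rewrite adjmxM {1}eqA invmx_unitary// -!mulmxA; congr (_ *m _).
rewrite mulmxA; congr (_ *m _).
apply/matrixP => i j; rewrite !mxE (bigD1 i)//= big1 => [|k ki].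
  rewrite !mxE eqxx addr0 mulr1n.
  case: eqVneq => [_|_]; last by rewrite !mulr0n mulr0.
  by rewrite !mulr1n geC0_conj ?sqrtC_ge0// -expr2 sqrtCK.
by rewrite !mxE (negbTE ki) mulr0n conjC0 mul0r.
Qed.

Lemma psdmx1 D : psdmx (1%:M : 'M[C]_D).
Proof. by have := gram_psdmx (1%:M : 'M[C]_D); rewrite mulmx1 adjmx1. Qed.

Lemma psdmx_conj p D (A : 'M[C]_D) (B : 'M[C]_(p, D)) :
  psdmx A -> psdmx (B *m A *m B^t*).
Proof.
move=> /psdmx_gram[G ->]; have := gram_psdmx (G *m B^t*).
by rewrite adjmxM trmxCK !mulmxA.
Qed.

(** With a Gram factor [G] of [B], cyclicity turns the trace into that of [G *m A *m G^t*]. *)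
Lemma psdmx_trace_ge0 D (A B : 'M[C]_D) : psdmx A -> psdmx B -> 0 <= \tr (A *m B).
Proof.
move=> psdA /psdmx_gram[G ->]; rewrite mulmxA mxtrace_mulC mulmxA.
by rewrite sumr_ge0 // => k _; exact: psdmx_conj_diag_ge0.
Qed.

Lemma psdmx_sum D m (p : 'I_m -> R) (A : 'I_m -> 'M[C]_D) :
    (forall j, 0 <= p j) -> (forall j, psdmx (A j)) ->
  psdmx (\sum_j (p j)%:C *: A j).
Proof.
move=> p0 psdA; split => [|v].
  apply/hermsymmxP; rewrite linear_sum map_mx_sum; apply: eq_bigr => j _.
  rewrite linearZ /= map_mxZ; have [/hermsymmxP eqA _] := psdA j.
  by rewrite eqA; congr (_ *: _); apply: geC0_conj; rewrite ler0c.
rewrite mulmx_sumr mulmx_suml summxE sumr_ge0 // => j _.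
rewrite -scalemxAr -scalemxAl mxE mulr_ge0 ?ler0c//.
by have [_] := psdA j.
Qed.

Lemma density_conj D (U rho : 'M[C]_D) :
  U \is unitarymx -> density rho -> density (U *m rho *m U^t*).
Proof.
move=> uU [psd_rho tr_rho]; split; first exact: psdmx_conj.
by rewrite mxtrace_mulC mulmxA unitarymx_adjmxM// mul1mx.
Qed.

(** For a Gram factor [B], [N k] is the squared norm of column [k], equal to the diagonal entry of
    the state and so at most the trace 1. The inequality between arithmetic and geometric means,
    applied termwise, bounds an entry by [(N i + N j) / 2]. *)
Lemma density_entry_le1 D (rho : 'M[C]_D) i j :
  density rho -> `|rho i j| <= 1.
Proof.
move=> [/psdmx_gram[B ->] tr1].
pose N k := \sum_l `|B l k| ^+ 2.
have NE k : (B^t* *m B) k k = N k.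
  by rewrite mxE; apply: eq_bigr => l _; rewrite adjmxE normCK mulrC.
have N0 k : 0 <= N k by rewrite sumr_ge0 // => l _; rewrite exprn_ge0.
have N1 k : N k <= 1.
  by rewrite -tr1 /mxtrace (bigD1 k)//= NE lerDl sumr_ge0 // => l _; rewrite NE.
rewrite mxE (le_trans (ler_norm_sum _ _ _))//.
apply: (@le_trans _ _ ((N i + N j) / 2)); last first.
  by rewrite ler_pdivrMr// mul1r -[2]/(1 + 1) lerD.
rewrite ler_pdivlMr// mulr_suml /N -big_split /= ler_sum // => l _.
rewrite adjmxE normrM norm_conjC mulr_natr -subr_ge0.
have -> : `|B l i| ^+ 2 + `|B l j| ^+ 2 - `|B l i| * `|B l j| *+ 2 =
  (`|B l i| - `|B l j|) ^+ 2 by ring.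
by rewrite real_exprn_even_ge0 // rpredB // normr_real.
Qed.

(** A crude bound, but uniform in the state: it makes the n-cell maxima grow at most linearly. *)
Lemma density_energy_le D (rho h : 'M[C]_D) : density rho ->
  `|energy rho h| <= complex.Re (\sum_i \sum_j `|h i j|).
Proof.
move=> rhoD; rewrite -lecR.
have S0 : 0 <= \sum_i \sum_j `|h i j|.
  by rewrite sumr_ge0 // => i _; rewrite sumr_ge0.
rewrite RRe_real ?ger0_real// (le_trans (normc_ge_Re _))//.
rewrite exchange_big /= (le_trans (ler_norm_sum _ _ _))// ler_sum // => i _.
rewrite mxE (le_trans (ler_norm_sum _ _ _))// ler_sum // => j _.
by rewrite normrM ler_piMl// density_entry_le1.
Qed.

End Psd.

(** Positivity of [L] is complete positivity with a one-dimensional ancilla. The map [ix] identifies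
    the indices of size [d] with those of size [1 * d]. *)
Lemma lcpt_density (R : realType) d (L : {linear 'M[R[i]]_d -> 'M[R[i]]_d}) rho :
  lcpt L -> density rho -> density (L rho).
Proof.
move=> [cpL tpL] [/psdmx_gram[B eq_rho] tr_rho]; split; last by rewrite tpL.
have : psdmx ((1%:M : 'M[R[i]]_1) *t rho).
  have := gram_psdmx ((1%:M : 'M[R[i]]_1) *t B).
  by rewrite trmx_tens map_mxT tensmx_mul adjmx1 mulmx1 -eq_rho.
move=> /cpL; rewrite ampliation_tens => /psdmx_gram[G eqG].
pose ix (a : 'I_d) := mxtens_index (0 : 'I_1, a).
have -> : L rho = (colsub ix G)^t* *m colsub ix G; last exact: gram_psdmx.
apply/matrixP => a b.
have := congr1 (fun M : 'M[R[i]]_(1 * d) => M (ix a) (ix b)) eqG.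
rewrite tensmxE !mxE eqxx mul1r => ->.
by apply: eq_bigr => k _; rewrite !mxE.
Qed.

End PositiveMatrices.

(** * Tensor products over n cells, local observables, marginals and channel powers *)

Section TensorPowers.
Set Implicit Arguments.
Unset Strict Implicit.
Unset Printing Implicit Defensive.
Local Open Scope sesquilinear_scope.

Lemma label_bij n d : bijective (@label n d).
Proof. exact: enum_val_bij. Qed.

Lemma label_eq n d (x y : 'I_(ndim n d)) :
  (x == y) = [forall i, label x i == label y i].
Proof.
rewrite -(inj_eq (bij_inj (label_bij n d))).
by apply/eqP/'forall_eqP => [->|/ffunP].
Qed.

(** Sums over the basis become sums over functions, the shape produced when a product of sums is
    distributed. *)
Lemma sum_label (V : nmodType) n d (F : {ffun 'I_n -> 'I_d} -> V) :
  \sum_(x : 'I_(ndim n d)) F (label x) = \sum_f F f.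
Proof. by rewrite [RHS](reindex (@label n d)) //; apply: onW_bij; exact: label_bij. Qed.

Section Tens.
Variables (R : realType) (n d : nat).
Local Notation C := R[i].
Local Notation nmx := 'M[C]_(ndim n d).
Implicit Types (A B U : 'I_n -> 'M[C]_d) (M : 'M[C]_d) (X : nmx).

Lemma eq_tens A B : A =1 B -> tens A = tens B.
Proof. by move=> /funext ->. Qed.

Lemma tensM A B : tens A *m tens B = tens (fun i => A i *m B i).
Proof.
apply/matrixP => x y; rewrite !mxE.
under [RHS]eq_bigr => i _ do rewrite mxE.
rewrite bigA_distr_bigA -sum_label; apply: eq_bigr => z _.
by rewrite !mxE -big_split.
Qed.

Lemma adj_tens A : (tens A)^t* = tens (fun i => (A i)^t*).
Proof.
apply/matrixP => x y; rewrite !mxE rmorph_prod.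
by apply: eq_bigr => i _; rewrite !mxE.
Qed.

Lemma mxtrace_tens A : \tr (tens A) = \prod_i \tr (A i).
Proof.
rewrite /mxtrace bigA_distr_bigA -sum_label.
by apply: eq_bigr => x _; rewrite mxE.
Qed.

Lemma tens_delta (x y : 'I_(ndim n d)) :
  tens (fun i => delta_mx (label x i) (label y i)) = delta_mx x y :> nmx.
Proof.
apply/matrixP => s t; rewrite !mxE.
under eq_bigr => i _ do rewrite mxE.
rewrite !label_eq; case: (boolP (_ && _)) => [/andP[/forallP sx /forallP ty]|].
  by rewrite big1 // => i _; rewrite sx ty.
rewrite negb_and => /orP[] /forallPn/= [i /negbTE ne].
  by rewrite (bigD1 i)//= ne mul0r.
by rewrite (bigD1 i)//= ne andbF mul0r.
Qed.

Lemma tens1 : tens (fun=> 1%:M) = 1%:M :> nmx.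
Proof.
apply/matrixP => s t; rewrite !mxE label_eq.
under eq_bigr => i _ do rewrite mxE.
case: (boolP [forall _, _]) => [/forallP st|/forallPn/= [i /negbTE ne]].
  by rewrite big1 // => i _; rewrite st.
by rewrite (bigD1 i)//= ne mul0r.
Qed.

(** Product matrices span, since every matrix unit is one of them by [tens_delta]. *)
Lemma tens_ext (V : lmodType C) (f g : {linear nmx -> V}) :
  (forall A, f (tens A) = g (tens A)) -> f =1 g.
Proof.
move=> fg X; rewrite [X]matrix_sum_delta !linear_sum; apply: eq_bigr => x _.
rewrite !linear_sum; apply: eq_bigr => y _.
by rewrite !linearZ /= -tens_delta fg.
Qed.

Lemma tens_unitarymx U : (forall i, U i \is unitarymx) -> tens U \is unitarymx.
Proof.
move=> uU; apply/unitarymxP; rewrite adj_tens tensM -tens1.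
by apply: eq_tens => i; exact/unitarymxP.
Qed.

(** A tensor product of Gram matrices is the Gram matrix of the tensor product of chosen factors. *)
Lemma tens_psdmx A : (forall i, psdmx (A i)) -> psdmx (tens A).
Proof.
move=> /(_ _)/psdmx_gram/cid psdA; pose B i := projT1 (psdA i).
have -> : tens A = (tens B)^t* *m tens B; last exact: gram_psdmx.
by rewrite adj_tens tensM; apply: eq_tens => i; rewrite /B; case: (psdA i).
Qed.

Lemma tens_density A : (forall i, density (A i)) -> density (tens A).
Proof.
move=> dA; split; first by apply: tens_psdmx => i; have [] := dA i.
by rewrite mxtrace_tens big1 // => i _; have [] := dA i.
Qed.

Lemma separable_density (rho : nmx) : separable rho -> density rho.
Proof.
move=> [m [p [s [p0 p1 sD ->]]]]; split.
  by apply: psdmx_sum => // j; have [] := tens_density (sD j).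
rewrite linear_sum -[RHS]/((1 : R)%:C) -p1 rmorph_sum; apply: eq_bigr => j _.
by rewrite linearZ /= (tens_density (sD j)).2 mulr1.
Qed.

Lemma tens_separable A : (forall i, density (A i)) -> separable (tens A).
Proof.
move=> dA; exists 1%N, (fun=> 1), (fun=> A); split => //; first by rewrite big_ord1.
by rewrite big_ord1 scale1r.
Qed.

(** The body repeats the summand of [nhamiltonian], so the Hamiltonian is a sum of [local_op i h] by
    conversion. *)
Definition local_op (i : 'I_n) M : nmx :=
  tens (fun k => if k == i then M else 1%:M).

Lemma local_opE i M x y : local_op i M x y = M (label x i) (label y i) *
  \prod_(k | k != i) (1%:M : 'M[C]_d) (label x k) (label y k).
Proof.
rewrite mxE (bigD1 i)//= eqxx; congr (_ * _).
by apply: eq_bigr => k /negbTE ->.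
Qed.

Lemma local_op_is_linear i : linear (local_op i).
Proof.
move=> a M N; apply/matrixP => x y.
by rewrite [RHS]mxE [X in _ = X + _]mxE !local_opE !mxE mulrDl mulrA.
Qed.

HB.instance Definition _ i :=
  GRing.isLinear.Build C 'M[C]_d nmx *:%R (local_op i) (local_op_is_linear i).

Lemma local_op1 i : local_op i 1%:M = 1%:M.
Proof. by rewrite -tens1; apply: eq_tens => k; case: ifP. Qed.

Lemma adj_local_op i M : (local_op i M)^t* = local_op i (M^t*).
Proof.
by rewrite adj_tens; apply: eq_tens => k; case: ifP => // _; exact: adjmx1.
Qed.

Lemma local_op_psdmx i M : psdmx M -> psdmx (local_op i M).
Proof.
by move=> psdM; apply: tens_psdmx => k; case: ifP => // _; exact: psdmx1.
Qed.

(** Away from cell [i] the unitaries meet only the identity and cancel. *)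
Lemma local_op_conj i U M : (forall k, U k \is unitarymx) ->
  (tens U)^t* *m local_op i M *m tens U = local_op i ((U i)^t* *m M *m U i).
Proof.
move=> uU; rewrite adj_tens !tensM; apply: eq_tens => k.
by case: eqP => [->//|_]; rewrite mulmx1 unitarymx_adjmxM.
Qed.

(* The partial trace onto the i-th cell, defined by duality with the
   observables of that cell; see mxtrace_mul_local_op. *)
Definition marginal (i : 'I_n) X : 'M[C]_d :=
  \matrix_(a, b) \tr (X *m local_op i (delta_mx b a)).

Lemma marginal_is_linear i : linear (marginal i).
Proof.
move=> a X Y; apply/matrixP => s t.
by rewrite !mxE mulmxDl -scalemxAl linearD linearZ.
Qed.

HB.instance Definition _ i :=
  GRing.isLinear.Build C nmx 'M[C]_d *:%R (marginal i) (marginal_is_linear i).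

Lemma mxtrace_mul_local_op i X M :
  \tr (X *m local_op i M) = \tr (marginal i X *m M).
Proof.
have -> : local_op i M = \sum_a \sum_b M a b *: local_op i (delta_mx a b).
  rewrite {1}[M]matrix_sum_delta linear_sum; apply: eq_bigr => a _.
  by rewrite linear_sum; apply: eq_bigr => b _; rewrite linearZ.
rewrite mulmx_sumr raddf_sum.
under eq_bigr => a _ do rewrite mulmx_sumr raddf_sum.
rewrite exchange_big; apply: eq_bigr => b _; rewrite mxE; apply: eq_bigr => a _.
by rewrite -scalemxAr /= mxtraceZ mxE mulrC.
Qed.

Lemma marginal_tens i A :
  marginal i (tens A) = (\prod_(k | k != i) \tr (A k)) *: A i.
Proof.
apply/matrixP => a b; rewrite !mxE tensM mxtrace_tens (bigD1 i)//= eqxx.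
rewrite mxtrace_mul_delta mulrC; congr (_ * _).
by apply: eq_bigr => k /negbTE ->; rewrite mulmx1.
Qed.

Lemma mxtrace_marginal i X : \tr (marginal i X) = \tr X.
Proof. by rewrite -[marginal i X]mulmx1 -mxtrace_mul_local_op local_op1 mulmx1. Qed.

Lemma marginal_density i X : density X -> density (marginal i X).
Proof.
move=> [psdX trX]; split; last by rewrite mxtrace_marginal.
have [/hermsymmxP hermX _] := psdX.
split=> [|v].
  apply/hermsymmxP/matrixP => a b; rewrite adjmxE [LHS]/= !mxE -mxtrace_adj.
  by rewrite adjmxM hermX adj_local_op mxtrace_mulC trmx_delta map_delta_mx.
(* By duality the quadratic form at [v] is the trace of [X] against the local observable
   [v *m v^t*], a product of two positive matrices. *)
rewrite -trace_mx11 -mulmxA mxtrace_mulC -mulmxA -mxtrace_mul_local_op.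
apply: psdmx_trace_ge0 => //; apply: local_op_psdmx.
by have := gram_psdmx (v^t*); rewrite trmxCK.
Qed.

(** Without interaction every term of the Hamiltonian sees one cell only, so the marginals determine
    the energy. *)
Lemma energy_nhamiltonian X h :
  energy X (nhamiltonian n h) = \sum_i energy (marginal i X) h.
Proof.
rewrite /energy /nhamiltonian mulmx_sumr [\tr _](raddf_sum (@mxtrace _ _)) raddf_sum.
by apply: eq_bigr => i _; rewrite -mxtrace_mul_local_op.
Qed.

Lemma energy_tens A h : (forall i, \tr (A i) = 1) ->
  energy (tens A) (nhamiltonian n h) = \sum_i energy (A i) h.
Proof.
move=> trA; rewrite energy_nhamiltonian; apply: eq_bigr => i _.
by rewrite marginal_tens big1 ?scale1r.
Qed.

Lemma density_nenergy_le X h : density X ->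
  `|energy X (nhamiltonian n h)| <=
    n%:R * complex.Re (\sum_i \sum_j `|h i j|).
Proof.
move=> dX; rewrite energy_nhamiltonian (le_trans (ler_norm_sum _ _ _))//.
rewrite (le_trans (ler_sum _ (fun i _ => density_energy_le h (marginal_density i dX))))//.
by rewrite sumr_const card_ord mulr_natl.
Qed.

Lemma energy_local_conj U X h : (forall k, U k \is unitarymx) ->
  energy (tens U *m X *m (tens U)^t*) (nhamiltonian n h) =
  \sum_i energy (U i *m marginal i X *m (U i)^t*) h.
Proof.
move=> uU; rewrite energy_nhamiltonian; apply: eq_bigr => i _.
(* Cyclicity of the trace moves the unitaries from the state to the observable, where
   [local_op_conj] leaves only [U i]. *)
congr complex.Re; rewrite -mxtrace_mul_local_op -!mulmxA mxtrace_mulC.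
rewrite -!mulmxA mulmxA -mulmxA (mulmxA _ (local_op i h)) local_op_conj//.
by rewrite mxtrace_mul_local_op !mulmxA mxtrace_mulC !mulmxA.
Qed.

Variable L : {linear 'M[C]_d -> 'M[C]_d}.

Lemma chan_pow_is_linear : linear (@chan_pow R d n L).
Proof.
move=> a X Y; rewrite /chan_pow scaler_sumr -big_split; apply: eq_bigr => x _.
rewrite scaler_sumr -big_split; apply: eq_bigr => y _.
by rewrite !mxE scalerDl scalerA.
Qed.

HB.instance Definition _ :=
  GRing.isLinear.Build C nmx nmx *:%R (@chan_pow R d n L) chan_pow_is_linear.

(** Both sides are linear in [X], so products suffice; there the other cells contribute only their
    traces, which [L] preserves. Hence the identity also covers entangled [X]. *)
Lemma marginal_chan_pow i X : trace_preserving L ->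
  marginal i (chan_pow L X) = L (marginal i X).
Proof.
move=> tpL.
apply: (@tens_ext _ (marginal i \o chan_pow L) (L \o marginal i)) => A /=.
rewrite chan_pow_tens !marginal_tens linearZ; congr (_ *: _).
by apply: eq_bigr => k _; rewrite tpL.
Qed.

(** Together with [separable_density] this shows that outputs of separable inputs are states; it
    only uses positivity of [L] on one cell. *)
Lemma chan_pow_separable (rho : nmx) :
  lcpt L -> separable rho -> separable (chan_pow L rho).
Proof.
move=> lL [m [p [s [p0 p1 sD ->]]]].
exists m, p, (fun j i => L (s j i)); split=> // [j i|]; first exact: lcpt_density.
rewrite linear_sum; apply: eq_bigr => j _.
by rewrite linearZ /= chan_pow_tens.
Qed.

End Tens.
End TensorPowers.

(** * Juxtaposition of n cells and m cells *)

Section JoinedCells.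
Set Implicit Arguments.
Unset Strict Implicit.
Unset Printing Implicit Defensive.
Local Open Scope sesquilinear_scope.

Variables (R : realType) (n m d : nat).
Local Notation C := R[i].
Implicit Types (X : 'M[C]_(ndim n d)) (Y : 'M[C]_(ndim m d)).

Definition cat_fun T (f : 'I_n -> T) (g : 'I_m -> T) (k : 'I_(n + m)) : T :=
  match fintype.split k with inl i => f i | inr j => g j end.

Lemma cat_fun_lshift T (f : 'I_n -> T) (g : 'I_m -> T) i :
  cat_fun f g (lshift m i) = f i.
Proof. by rewrite /cat_fun (unsplitK (inl i)). Qed.

Lemma cat_fun_rshift T (f : 'I_n -> T) (g : 'I_m -> T) j :
  cat_fun f g (rshift n j) = g j.
Proof. by rewrite /cat_fun (unsplitK (inr j)). Qed.

Lemma cat_funP T (P : T -> Prop) (f : 'I_n -> T) (g : 'I_m -> T) :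
  (forall i, P (f i)) -> (forall j, P (g j)) -> forall k, P (cat_fun f g k).
Proof. by move=> Pf Pg k; rewrite /cat_fun; case: fintype.split. Qed.

Definition left_label (x : 'I_(ndim (n + m) d)) : 'I_(ndim n d) :=
  enum_rank [ffun i => label x (lshift m i)].

Definition right_label (x : 'I_(ndim (n + m) d)) : 'I_(ndim m d) :=
  enum_rank [ffun j => label x (rshift n j)].

Lemma label_left x i : label (left_label x) i = label x (lshift m i).
Proof. by rewrite /label enum_rankK ffunE. Qed.

Lemma label_right x j : label (right_label x) j = label x (rshift n j).
Proof. by rewrite /label enum_rankK ffunE. Qed.

Lemma left_right_label_bij : bijective (fun x => (left_label x, right_label x)).
Proof.
exists (fun z : 'I_(ndim n d) * 'I_(ndim m d) =>
  enum_rank [ffun k => cat_fun (label z.1) (label z.2) k]) => [x|[y z]].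
  apply/eqP; rewrite label_eq; apply/forallP => k /=.
  rewrite {1}/label enum_rankK ffunE -(splitK k).
  by case: (fintype.split k) => i /=; rewrite ?cat_fun_lshift ?cat_fun_rshift
    ?label_left ?label_right.
congr pair; apply/eqP; rewrite label_eq; apply/forallP => i.
  by rewrite label_left {1}/label enum_rankK ffunE cat_fun_lshift.
by rewrite label_right {1}/label enum_rankK ffunE cat_fun_rshift.
Qed.

Lemma sum_left_right (V : nmodType) (F : 'I_(ndim n d) -> 'I_(ndim m d) -> V) :
  \sum_x F (left_label x) (right_label x) = \sum_y \sum_z F y z.
Proof.
rewrite pair_bigA [RHS](reindex (fun x => (left_label x, right_label x))) //.
by apply: onW_bij; exact: left_right_label_bij.
Qed.

(** The Kronecker product of [X] and [Y], carried to the basis of [n + m] cells by the bijection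
    [left_right_label_bij]. *)
Definition join X Y : 'M[C]_(ndim (n + m) d) :=
  \matrix_(x, y) (X (left_label x) (left_label y) *
                  Y (right_label x) (right_label y)).

Lemma join_is_linear X : linear (join X).
Proof. by move=> a Y Z; apply/matrixP => x y; rewrite !mxE; ring. Qed.

HB.instance Definition _ X :=
  GRing.isLinear.Build C 'M[C]_(ndim m d) 'M[C]_(ndim (n + m) d) *:%R
    (join X) (join_is_linear X).

(** The flipped map has a name so that linearity in the first argument can be registered. *)
Definition joinr Y := join^~ Y.

Lemma joinr_is_linear Y : linear (joinr Y).
Proof. by move=> a X Z; apply/matrixP => x y; rewrite !mxE; ring. Qed.

HB.instance Definition _ Y :=
  GRing.isLinear.Build C 'M[C]_(ndim n d) 'M[C]_(ndim (n + m) d) *:%R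
    (joinr Y) (joinr_is_linear Y).

Lemma join_tens A B : join (tens A) (tens B) = tens (cat_fun A B).
Proof.
apply/matrixP => x y; rewrite !mxE big_split_ord.
congr (_ * _); apply: eq_bigr => i _.
  by rewrite !label_left cat_fun_lshift.
by rewrite !label_right cat_fun_rshift.
Qed.

Lemma joinM X Y X' Y' : join X Y *m join X' Y' = join (X *m X') (Y *m Y').
Proof.
apply/matrixP => x y; rewrite !mxE mulr_suml.
under [RHS]eq_bigr => a _ do rewrite mulr_sumr.
by rewrite -sum_left_right; apply: eq_bigr => z _; rewrite !mxE; ring.
Qed.

Lemma adj_join X Y : (join X Y)^t* = join (X^t*) (Y^t*).
Proof. by apply/matrixP => x y; rewrite !mxE rmorphM. Qed.

Lemma join11 : join 1%:M 1%:M = 1%:M.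
Proof.
rewrite -!tens1 join_tens; apply: eq_tens.
by apply: (@cat_funP _ (fun M => M = 1%:M)).
Qed.

Lemma mxtrace_join X Y : \tr (join X Y) = \tr X * \tr Y.
Proof.
rewrite /mxtrace mulr_suml.
under [RHS]eq_bigr => a _ do rewrite mulr_sumr.
by rewrite -sum_left_right; apply: eq_bigr => z _; rewrite mxE.
Qed.

Lemma join_unitarymx X Y :
  X \is unitarymx -> Y \is unitarymx -> join X Y \is unitarymx.
Proof.
move=> /unitarymxP uX /unitarymxP uY.
by apply/unitarymxP; rewrite adj_join joinM uX uY join11.
Qed.

Lemma join_nhamiltonian h : nhamiltonian (n + m) h =
  join (nhamiltonian n h) 1%:M + join 1%:M (nhamiltonian m h).
Proof.
rewrite -[join (nhamiltonian n h) _]/(joinr _ _) !linear_sum /nhamiltonian big_split_ord /=.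
by congr (_ + _); apply: eq_bigr => i _; rewrite /joinr -tens1 join_tens;
  apply: eq_tens => k; rewrite -(splitK k); case: (fintype.split k) => j /=;
  rewrite ?cat_fun_lshift ?cat_fun_rshift ?(inj_eq (@lshift_inj _ _))
    ?(inj_eq (@rshift_inj _ _)) ?eq_lrshift ?eq_rlshift.
Qed.

Lemma energy_join X Y h : \tr X = 1 -> \tr Y = 1 ->
  energy (join X Y) (nhamiltonian (n + m) h) =
  energy X (nhamiltonian n h) + energy Y (nhamiltonian m h).
Proof.
move=> trX trY; rewrite /energy join_nhamiltonian mulmxDr mxtraceD !joinM.
by rewrite !mxtrace_join !mulmx1 trX trY mulr1 mul1r raddfD.
Qed.

(** Bilinearity reduces to products, first in the right argument and then in the left; on products
    both sides apply [L] cell by cell. *)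
Lemma chan_pow_join (L : {linear 'M[C]_d -> 'M[C]_d}) X Y :
  chan_pow L (join X Y) = join (chan_pow L X) (chan_pow L Y).
Proof.
apply: (@tens_ext _ _ _ _ (chan_pow L \o join X)
  (join (chan_pow L X) \o chan_pow L)) => B /=.
rewrite chan_pow_tens.
apply: (@tens_ext _ _ _ _ (chan_pow L \o joinr (tens B))
  (joinr (tens (fun j => L (B j))) \o chan_pow L)) => A /=.
rewrite /joinr !chan_pow_tens !join_tens chan_pow_tens; apply: eq_tens => k.
by rewrite /cat_fun; case: fintype.split.
Qed.

(** The joint mixture runs over pairs of indices with product weights; [mxtens_unindex] codes the
    pairs by ordinals below [s * t]. *)
Lemma join_separable X Y : separable X -> separable Y -> separable (join X Y).
Proof.
move=> [s [p [S [p0 p1 dS ->]]]] [t [q [T [q0 q1 dT ->]]]].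
have reix (V : nmodType) (F : 'I_s -> 'I_t -> V) :
    \sum_(j < s * t) F (mxtens_unindex j).1 (mxtens_unindex j).2 =
    \sum_a \sum_b F a b.
  rewrite pair_bigA [RHS](reindex (@mxtens_unindex s t))//.
  apply: onW_bij; exists (@mxtens_index s t).
    exact: mxtens_unindexK.
  exact: mxtens_indexK.
exists (s * t)%N, (fun j => p (mxtens_unindex j).1 * q (mxtens_unindex j).2),
  (fun j => cat_fun (S (mxtens_unindex j).1) (T (mxtens_unindex j).2)); split.
- by move=> j; rewrite mulr_ge0.
- rewrite (reix _ (fun a b => p a * q b)) -p1; apply: eq_bigr => a _.
  by rewrite -mulr_sumr q1 mulr1.
- by move=> j; apply: cat_funP.
- rewrite (reix _ (fun a b => (p a * q b)%:C *: tens (cat_fun (S a) (T b)))).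
  rewrite -[LHS]/(joinr _ _) linear_sum; apply: eq_bigr => a _.
  rewrite linearZ /= /joinr linear_sum scaler_sumr; apply: eq_bigr => b _.
  by rewrite linearZ scalerA /= join_tens rmorphM.
Qed.

End JoinedCells.

(** * Energy gains, the limits and their comparison *)

Section Capacitance.
Set Implicit Arguments.
Unset Strict Implicit.
Unset Printing Implicit Defensive.
Import numFieldNormedType.Exports.
Local Open Scope classical_set_scope.
Local Open Scope sesquilinear_scope.

Section Gain.
Variables (R : realType) (d : nat) (h : 'M[R[i]]_d).
Variable L : {linear 'M[R[i]]_d -> 'M[R[i]]_d}.
Hypothesis lL : lcpt L.

(** The quantity maximised in both problems: over all unitaries [U] in the global one, over those of
    the form [tens U] in the local one. *)
Definition gain n (rho U : 'M[R[i]]_(ndim n d)) : R :=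
  energy (chan_pow L rho) (nhamiltonian n h) -
  energy (U *m chan_pow L rho *m U^t*) (nhamiltonian n h).

Lemma gain1 n (rho : 'M[R[i]]_(ndim n d)) : gain rho 1%:M = 0.
Proof. by rewrite /gain adjmx1 mul1mx mulmx1 subrr. Qed.

Lemma separable_gain_le n (rho U : 'M[R[i]]_(ndim n d)) :
    separable rho -> U \is unitarymx ->
  gain rho U <= n%:R * (2 * complex.Re (\sum_i \sum_j `|h i j|)).
Proof.
move=> /(chan_pow_separable lL)/separable_density dX uU.
have := density_nenergy_le h (density_conj uU dX).
have := density_nenergy_le h dX.
rewrite !ler_norml /gain => /andP[_ ?] /andP[? _]; lra.
Qed.

(** Energies of joined matrices add once both factors have trace 1; separability of the inputs
    provides this for the channel outputs. *)
Lemma gain_join n m (rho U : 'M[R[i]]_(ndim n d)) (tau V : 'M[R[i]]_(ndim m d)) :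
    separable rho -> separable tau -> U \is unitarymx -> V \is unitarymx ->
  gain (join rho tau) (join U V) = gain rho U + gain tau V.
Proof.
move=> /(chan_pow_separable lL)/separable_density dX.
move=> /(chan_pow_separable lL)/separable_density dY uU uV.
rewrite /gain chan_pow_join adj_join !joinM.
rewrite !energy_join; [ring|..];
  by [have [] := dX | have [] := dY | have [] := density_conj uU dX
     | have [] := density_conj uV dY].
Qed.

Lemma sep_states_join n m (rho : 'M[R[i]]_(ndim n d))
    (tau : 'M[R[i]]_(ndim m d)) E F :
  sep_states h E rho -> sep_states h F tau -> sep_states h (E + F) (join rho tau).
Proof.
move=> [[drho Erho] srho] [[dtau Etau] stau]; split; last exact: join_separable.
split; first by apply: separable_density; exact: join_separable.
by rewrite energy_join ?drho.2 ?dtau.2// lerD.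
Qed.

Lemma marginal_tens_marginal n (rho : 'M[R[i]]_(ndim n d)) i :
  density rho -> marginal i (tens (fun k => marginal k rho)) = marginal i rho.
Proof.
move=> [_ tr_rho]; rewrite marginal_tens big1 ?scale1r // => k _.
by rewrite mxtrace_marginal.
Qed.

Lemma tens_marginal_sep_states n (rho : 'M[R[i]]_(ndim n d)) E :
  states h E rho -> sep_states h E (tens (fun k => marginal k rho)).
Proof.
move=> [drho Erho]; have dm i := marginal_density i drho.
split; last exact: tens_separable.
split; first exact: tens_density.
by rewrite energy_tens -?energy_nhamiltonian// => i; have [] := dm i.
Qed.

(* Energies before and after local unitaries only depend on the marginals. *)
Lemma gain_tens_marginal n (rho : 'M[R[i]]_(ndim n d)) U :
    density rho -> (forall i, U i \is unitarymx) ->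
  gain (tens (fun k => marginal k rho)) (tens U) = gain rho (tens U).
Proof.
move=> drho uU; have [_ tpL] := lL.
have eq_marg i : marginal i (chan_pow L (tens (fun k => marginal k rho))) =
    marginal i (chan_pow L rho).
  by rewrite !(marginal_chan_pow _ _ tpL) marginal_tens_marginal.
rewrite /gain; congr (_ - _).
  rewrite [LHS]energy_nhamiltonian [RHS]energy_nhamiltonian.
  by apply: eq_bigr => i _; rewrite eq_marg.
rewrite [LHS](energy_local_conj _ _ uU) [RHS](energy_local_conj _ _ uU).
by apply: eq_bigr => i _; rewrite eq_marg.
Qed.

End Gain.

(** The projector onto a row eigenvector for the eigenvalue 0. It makes the sets of states nonempty
    for every nonnegative energy budget. *)
Lemma qcell_ground_state (R : realType) d (h : 'M[R[i]]_d) :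
  qcell_hamiltonian h -> exists2 rho, density rho & energy rho h = 0.
Proof.
move=> [_ /eigenvalueP[v vh v0] _]; rewrite scale0r in vh.
pose c := \tr (v^t* *m v).
have cE : c = \sum_k `|v 0 k| ^+ 2.
  apply: eq_bigr => k _; rewrite mxE big_ord1 adjmxE normCK; exact: mulrC.
have c0 : 0 <= c by rewrite cE sumr_ge0 // => k _; rewrite exprn_ge0.
have cN0 : c != 0.
  apply: contra v0 => /eqP; rewrite cE => /eqP.
  rewrite psumr_eq0 => [/allP v2|k _]; last by rewrite exprn_ge0.
  apply/eqP/rowP => k; rewrite mxE; apply/eqP.
  by have := v2 k (mem_index_enum _); rewrite /= expf_eq0 /= normr_eq0.
(* [c] is the squared norm of [v], so [a *: v] is a unit vector. *)
pose a := (sqrtC c)^-1.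
have a0 : 0 <= a by rewrite invr_ge0 sqrtC_ge0.
exists ((a *: v)^t* *m (a *: v)).
  split; first exact: gram_psdmx.
  rewrite -scalemxAr [(a *: v)^T]linearZ /= map_mxZ -scalemxAl !mxtraceZ.
  rewrite [X in a * (X * _)](_ : _ = a); last exact: geC0_conj.
  rewrite mulrA -expr2 exprVn sqrtCK.
  by rewrite mulVf.
by rewrite /energy -mulmxA -scalemxAl vh scaler0 mulmx0 mxtrace0.
Qed.

Section Sequences.
Variables (R : realType) (d : nat) (h : 'M[R[i]]_d).
Variable L : {linear 'M[R[i]]_d -> 'M[R[i]]_d}.
Variable e : R.
Hypotheses (hq : qcell_hamiltonian h) (lL : lcpt L) (e0 : 0 <= e).

Let K : R := 2 * complex.Re (\sum_i \sum_j `|h i j|).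
Let a_sep n := max_ergotropy_sep n h L (n%:R * e).
Let a_loc n := max_ergotropy_loc n h L (n%:R * e).
Let S n := @sep_states R d n h (n%:R * e).
Let T n := @states R d n h (n%:R * e).
Let globU n := [set U : 'M[R[i]]_(ndim n d) | U \is unitarymx].
Let locU n := [set U : 'I_n -> 'M[R[i]]_d | forall i, U i \is unitarymx].

Arguments S : clear implicits.
Arguments T : clear implicits.
Arguments globU : clear implicits.
Arguments locU : clear implicits.

Let S_neq0 n : S n !=set0.
Proof.
have [rho drho Erho] := qcell_ground_state hq.
exists (tens (fun=> rho)); split; last exact: tens_separable.
split; first exact: tens_density.
rewrite energy_tens => [|_]; last by have [] := drho.
by rewrite big1 ?mulr_ge0.
Qed.

Let T_neq0 n : T n !=set0.
Proof. by have [rho [? _]] := S_neq0 n; exists rho. Qed.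

Let globU_neq0 n : globU n !=set0.
Proof. by exists 1%:M; apply/unitarymxP; rewrite adjmx1 mulmx1. Qed.

Let locU1 n : locU n (fun=> 1%:M).
Proof. by move=> i; apply/unitarymxP; rewrite adjmx1 mulmx1. Qed.

Let locU_neq0 n : locU n !=set0.
Proof. by exists (fun=> 1%:M); exact: locU1. Qed.

Let sep_gain_le n rho U : S n rho -> globU n U -> gain h L rho U <= n%:R * K.
Proof. by move=> [_ ?] ?; exact: separable_gain_le. Qed.

(** The central reduction: against local unitaries an arbitrary input is matched by the product of
    its marginals, with the same energy and the same gain. *)
Let loc_gain_sep n rho U : T n rho -> locU n U ->
  exists2 rho', S n rho' & gain h L rho' (tens U) = gain h L rho (tens U).
Proof.
move=> Trho UU; exists (tens (fun k => marginal k rho)).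
  exact: tens_marginal_sep_states.
by apply: gain_tens_marginal => //; have [] := Trho.
Qed.

Let loc_gain_le n rho U : T n rho -> locU n U -> gain h L rho (tens U) <= n%:R * K.
Proof.
move=> Trho UU; have [rho' Srho' <-] := loc_gain_sep Trho UU.
by apply: sep_gain_le => //; exact: tens_unitarymx.
Qed.

Let a_sep_ub n rho U : S n rho -> globU n U -> gain h L rho U <= a_sep n.
Proof.
by move=> ? ?; apply: (le_nested_sup (globU_neq0 n) (@sep_gain_le n)).
Qed.

Let a_loc_ub n rho U : T n rho -> locU n U -> gain h L rho (tens U) <= a_loc n.
Proof.
move=> Trho UU.
exact: (@le_nested_sup _ _ _ _ _ (fun rho U => gain h L rho (tens U)) _
  (locU_neq0 n) (@loc_gain_le n)).
Qed.

Let a_sep_le n z :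
  (forall rho U, S n rho -> globU n U -> gain h L rho U <= z) -> a_sep n <= z.
Proof. exact: nested_sup_le. Qed.

Let a_loc_le n z :
    (forall rho U, T n rho -> locU n U -> gain h L rho (tens U) <= z) ->
  a_loc n <= z.
Proof.
exact: (@nested_sup_le _ _ _ _ _ (fun rho U => gain h L rho (tens U))).
Qed.

Let join_S m n rho tau : S m rho -> S n tau -> S (m + n) (join rho tau).
Proof. by move=> /sep_states_join Srho /Srho; rewrite -mulrDl -natrD. Qed.

Lemma max_ergotropy_sep_is_cvg :
  cvgn (fun n => max_ergotropy_sep n h L (n%:R * e) / n%:R).
Proof.
apply: (@superadditive_is_cvg _ _ K) => [n|n|m n].
- have [rho Srho] := S_neq0 n; rewrite -(gain1 h L rho).
  by apply: a_sep_ub => //; apply/unitarymxP; rewrite adjmx1 mulmx1.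
- by apply: a_sep_le => rho U; exact: sep_gain_le.
(* Superadditivity: the two maxima on the left are bounded one after the other, each time moving the
   other one across the inequality. What remains is to join inputs and unitaries. *)
- rewrite -lerBrDr; apply: a_sep_le => rho U Srho UU.
  rewrite lerBrDr -lerBrDl; apply: a_sep_le => tau V Stau UV.
  rewrite lerBrDl -gain_join//; [|by have [] := Srho|by have [] := Stau].
  by apply: a_sep_ub; [exact: join_S|exact: join_unitarymx].
Qed.

Lemma max_ergotropy_loc_is_cvg :
  cvgn (fun n => max_ergotropy_loc n h L (n%:R * e) / n%:R).
Proof.
apply: (@superadditive_is_cvg _ _ K) => [n|n|m n].
- have [rho Trho] := T_neq0 n; rewrite -(gain1 h L rho) -tens1.
  exact: a_loc_ub.
- by apply: a_loc_le => rho U; exact: loc_gain_le.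
- rewrite -lerBrDr; apply: a_loc_le => rho U Trho UU.
  rewrite lerBrDr -lerBrDl; apply: a_loc_le => tau V Ttau UV.
  (* Gains add for separable inputs, so both inputs are first replaced by products of marginals. *)
  have [rho' Srho' <-] := loc_gain_sep Trho UU.
  have [tau' Stau' <-] := loc_gain_sep Ttau UV.
  rewrite lerBrDl -gain_join//; [|by have [] := Srho'|by have [] := Stau'|
    exact: tens_unitarymx|exact: tens_unitarymx].
  (* Two families of local unitaries concatenate to one, so the joined unitary is again local. *)
  rewrite join_tens; apply: a_loc_ub; first by have [] := join_S Srho' Stau'.
  exact: (@cat_funP _ _ _ (fun V : 'M[R[i]]_d => V \is unitarymx)).
Qed.

Lemma max_ergotropy_loc_le_sep n :
  max_ergotropy_loc n h L (n%:R * e) <= max_ergotropy_sep n h L (n%:R * e).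
Proof.
apply: a_loc_le => rho U Trho UU; have [rho' Srho' <-] := loc_gain_sep Trho UU.
by apply: a_sep_ub => //; exact: tens_unitarymx.
Qed.

Lemma C_loc_le_C_sep : C_loc h L e <= C_sep h L e.
Proof.
apply: ler_lim max_ergotropy_loc_is_cvg max_ergotropy_sep_is_cvg _.
by apply: nearW => n; rewrite ler_wpM2r ?invr_ge0// max_ergotropy_loc_le_sep.
Qed.

End Sequences.
End Capacitance.

Theorem mainTheorem2 (R : realType) (d : nat) (h : 'M[R[i]]_d)
    (Lambda : {linear 'M[R[i]]_d -> 'M[R[i]]_d}) (e : R)
    (h_qcell : qcell_hamiltonian h) (Lambda_lcpt : lcpt Lambda)
    (e_range : 0 <= e <= opnorm h) :
  C_sep h Lambda e >= C_loc h Lambda e.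
Proof. by apply: C_loc_le_C_sep => //; case/andP: e_range. Qed.
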